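(* Let $X$ be a finite simplicial complex, $m \ge 0$ an integer, $p$ an odd prime, and let $\alpha^p \in C^m(X;\mathbb{F}_p)$ be a cocycle. Suppose there exists a scalar $r \in \mathbb{F}_p^*$ such that $r\alpha^p$ has all its coefficients in the range $$\mathcal{L}_m^p = \left\{-\left\lfloor \tfrac{p-1}{m+2}\right\rfloor, \dots, -1, 0, 1, \dots, \left\lfloor \tfrac{p-1}{m+2}\right\rfloor\right\}.$$ Then scaling together with the centered lift produces an integer cocycle in $C^m(X;\mathbb{Z})$ that is a preimage of $\alpha^p$ under reduction modulo $p$. That is, the centered lift $\beta \in C^m(X;\mathbb{Z})$ of $r\alpha^p$ is a cocycle, and for an integer $s$ representing $r^{-1} \in \mathbb{F}_p^*$, the cochain $s\beta \in C^m(X;\mathbb{Z})$ is a cocycle that reduces to $\alpha^p$ modulo $p$.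
   Context: $X^{(m)}$ denotes the set of $m$-simplices of $X$, and $C^m(X;R)$ denotes simplicial cochains with coefficients in $R$. A cochain is written $\sum_{\sigma\in X^{(m)}} \alpha_\sigma \sigma^*$ with coefficients $\alpha_\sigma\in R$, where $\sigma^*$ is dual to the (oriented) simplex $\sigma$. Centered lift: identify $\mathbb{F}_p$ with $\{0,1,\dots,p-1\}$. The centered lift of $\alpha^p = \sum_{\sigma} \alpha^p_\sigma \sigma^* \in C^m(X;\mathbb{F}_p)$ is the integer cochain $\alpha = \sum_\sigma \alpha_\sigma\sigma^*$ with $\alpha_\sigma = \alpha^p_\sigma$ if $\alpha^p_\sigma \le \frac{p-1}{2}$ and $\alpha_\sigma = \alpha^p_\sigma - p$ if $\alpha^p_\sigma > \frac{p-1}{2}$. A cochain over $\mathbb{F}_p$ has coefficients in the set of integers $\mathcal{L}_m^p$ if the coefficients of its centered lift lie in $\mathcal{L}_m^p$. *)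

(* Defs.v *)
From HB Require Import structures.
From mathcomp Require Import all_boot all_order all_algebra.

Set Implicit Arguments.
Unset Strict Implicit.
Unset Printing Implicit Defensive.

Import Order.TTheory GRing.Theory Num.Theory.
Local Open Scope ring_scope.

(* The vertex set of the complex is the union of its simplices; it need not be
   all of the ambient finite type V. *)
Record simplicial_complex (V : finType) := SimplicialComplex {
  simplices :> {set {set V}};
  simplices_neq0 : set0 \notin simplices;
  simplices_closed : forall sigma tau : {set V},
    sigma \in simplices -> tau \subset sigma -> tau != set0 ->
    tau \in simplices
}.

Definition msimplices (V : finType) (X : simplicial_complex V) (m : nat) :
  {set {set V}} := [set sigma in simplices X | #|sigma| == m.+1].

Definition msimplex (V : finType) (X : simplicial_complex V) (m : nat) :=
  {sigma : {set V} | sigma \in msimplices X m}.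

(* An orientation of a simplex is an ordering of its vertices up to even
   permutation; we record one representative ordering per simplex.  The choices
   for different simplices are unrelated, in particular they need not come from
   a global order on the vertices. *)
Record orientation (V : finType) (X : simplicial_complex V) := Orientation {
  vertex_seq :> {set V} -> seq V;
  vertex_seqP : forall sigma : {set V},
    sigma \in simplices X -> perm_eq (vertex_seq sigma) (enum sigma)
}.

(* For duplicate-free s and t with the same elements, (-1) ^+ inversions s t is
   the signature of the permutation taking s to t. *)
Definition inversions (V : finType) (s t : seq V) : nat :=
  #|[set xy : V * V | [&& xy.1 \in s, xy.2 \in s,
       (index xy.1 s < index xy.2 s)%N & (index xy.2 t < index xy.1 t)%N]]|.

(* [tau : sigma] = (-1)^i eps when tau = [v_0, ..., v_k], sigma is the face
   opposite v_i, and eps is the sign comparing the ordering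
   v_0, ..., v_(i-1), v_(i+1), ..., v_k with the chosen one of sigma; it is 0
   when sigma is not a facet of tau.  The sum has at most one term. *)
Definition incidence (V : finType) (X : simplicial_complex V)
    (o : orientation X) (tau sigma : {set V}) : int :=
  \sum_(v in tau | sigma == tau :\ v)
    (-1) ^+ index v (o tau) * (-1) ^+ inversions (rem v (o tau)) (o sigma).

(* C^m(X;R): a cochain is identified with its family of coefficients with
   respect to the duals of the chosen oriented m-simplices.  The regular module
   R^o provides the scaling r *: alpha. *)
Definition cochain (V : finType) (X : simplicial_complex V) (m : nat)
    (R : comNzRingType) := {ffun msimplex X m -> R^o}.

Definition coboundary (V : finType) (X : simplicial_complex V)
    (o : orientation X) (m : nat) (R : comNzRingType)
    (alpha : cochain X m R) : cochain X m.+1 R :=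
  [ffun tau : msimplex X m.+1 =>
    \sum_(sigma : msimplex X m)
      alpha sigma *~ incidence o (val tau) (val sigma)].

Definition cocycle (V : finType) (X : simplicial_complex V)
    (o : orientation X) (m : nat) (R : comNzRingType)
    (alpha : cochain X m R) : Prop :=
  coboundary o alpha = 0.

(* Meaningful for an odd prime p, when the elements of 'F_p are the ordinals
   0, ..., p - 1. *)
Definition centered_rep (p : nat) (a : 'F_p) : int :=
  if (a <= p.-1 %/ 2)%N then (a : nat)%:Z else (a : nat)%:Z - p%:Z.

Definition centered_lift (p : nat) (V : finType) (X : simplicial_complex V)
    (m : nat) (alpha : cochain X m 'F_p) : cochain X m int :=
  [ffun sigma => centered_rep (alpha sigma)].

Definition reduction (p : nat) (V : finType) (X : simplicial_complex V)
    (m : nat) (beta : cochain X m int) : cochain X m 'F_p :=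
  [ffun sigma => (beta sigma)%:~R].

Definition coef_range (m p : nat) : pred int :=
  [pred x : int | - (p.-1 %/ m.+2)%N%:Z <= x <= (p.-1 %/ m.+2)%N%:Z].

Definition has_coefs_in (p : nat) (L : pred int) (V : finType)
    (X : simplicial_complex V) (m : nat) (alpha : cochain X m 'F_p) : Prop :=
  forall sigma : msimplex X m, centered_lift alpha sigma \in L.

(* Main.v *)
(** The value of the coboundary of the centered lift on an (m+1)-simplex is a
    signed sum of at most m+2 coefficients, each bounded by (p-1)/(m+2), so its
    absolute value is at most p-1.  It also vanishes modulo p, hence it is 0. *)
Require Import Defs.
From HB Require Import structures.
From mathcomp Require Import all_boot all_order all_algebra.

Set Implicit Arguments.
Unset Strict Implicit.
Unset Printing Implicit Defensive.

Import Order.TTheory GRing.Theory Num.Theory.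
Local Open Scope ring_scope.

Lemma intr_Fp_eq0 (p : nat) (z : int) :
  prime p -> (z%:~R == 0 :> 'F_p) = (p %| `|z|)%N.
Proof.
move=> p_prime; rewrite (dvdn_pcharf (pchar_Fp p_prime)).
by case: (intP z) => [|n|n] //=; rewrite ?mulrNz ?oppr_eq0 ?abszN.
Qed.

(** The two branches differ by [p], which vanishes in ['F_p], so both reduce to the class of the
    natural number underlying [a]. *)
Lemma centered_repK (p : nat) (a : 'F_p) :
  prime p -> (centered_rep a)%:~R = a.
Proof.
move=> p_prime; have p0 : (p%:Z)%:~R = 0 :> 'F_p.
  by apply/eqP; rewrite intr_Fp_eq0 ?absz_nat.
rewrite /centered_rep; case: ifP => _; rewrite ?rmorphB /= ?p0 ?subr0.
all: exact: natr_Zp.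
Qed.

(** Each term of the incidence number is a product of two signs. The bound stays a sum over vertices
    so that it can later be exchanged with a sum over [sigma]. *)
Lemma norm_incidence_le (V : finType) (X : simplicial_complex V)
    (o : orientation X) (tau sigma : {set V}) :
  `|incidence o tau sigma| <= \sum_(v in tau) (sigma == tau :\ v)%:Z.
Proof.
rewrite /incidence big_mkcondr; apply: le_trans (ler_norm_sum _ _ _) _.
apply: ler_sum => v _; case: eqP => _; last by rewrite normr0.
by rewrite normrM !normrX !normrN !normr1 !expr1n mulr1.
Qed.

Lemma sum_norm_incidence_le (V : finType) (X : simplicial_complex V)
    (o : orientation X) (m : nat) (tau : {set V}) :
  \sum_(sigma : msimplex X m) `|incidence o tau (val sigma)| <= #|tau|%:Z.
Proof.
apply: le_trans (ler_sum _ (fun _ _ => norm_incidence_le _ _ _)) _.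
(* Double counting: with the vertex [v] fixed, at most one [sigma] equals [tau :\ v], so each vertex
   of [tau] contributes at most 1. *)
rewrite exchange_big -sum1_card (raddf_sum Posz) /=.
apply: ler_sum => v _; rewrite -(raddf_sum Posz) /= lez_nat -big_mkcond sum1_card.
apply/card_le1_eqP => s1 s2 s1_in s2_in; apply: val_inj.
by rewrite (eqP (s1_in : val s1 == tau :\ v)) (eqP (s2_in : val s2 == tau :\ v)).
Qed.

Lemma coboundaryZ (V : finType) (X : simplicial_complex V)
    (o : orientation X) (m : nat) (R : comNzRingType) (a : R)
    (alpha : cochain X m R) :
  coboundary o (a *: alpha) = a *: coboundary o alpha.
Proof.
apply/ffunP => tau; rewrite !ffunE scaler_sumr.
by apply: eq_bigr => sigma _; rewrite !ffunE scalerMzr.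
Qed.

Lemma cocycleZ (V : finType) (X : simplicial_complex V)
    (o : orientation X) (m : nat) (R : comNzRingType) (a : R)
    (alpha : cochain X m R) :
  cocycle o alpha -> cocycle o (a *: alpha).
Proof. by rewrite /cocycle coboundaryZ => ->; rewrite scaler0. Qed.

(** Incidence numbers are integers independent of the coefficient ring, so the coboundary is natural
    in ring morphisms, here from [int] to ['F_p]. *)
Lemma coboundary_reduction (p : nat) (V : finType) (X : simplicial_complex V)
    (o : orientation X) (m : nat) (beta : cochain X m int) :
  coboundary o (reduction p beta) = reduction p (coboundary o beta).
Proof.
apply/ffunP => tau; rewrite !ffunE rmorph_sum /=.
by apply: eq_bigr => sigma _; rewrite ffunE rmorphMz.
Qed.

Lemma reductionZ (p : nat) (V : finType) (X : simplicial_complex V)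
    (m : nat) (s : int) (beta : cochain X m int) :
  reduction p (s *: beta) = s%:~R *: reduction p beta.
Proof. by apply/ffunP => sigma; rewrite !ffunE rmorphM. Qed.

Lemma centered_liftK (p : nat) (V : finType) (X : simplicial_complex V)
    (m : nat) (alpha : cochain X m 'F_p) :
  prime p -> reduction p (centered_lift alpha) = alpha.
Proof. by move=> p_prime; apply/ffunP => s; rewrite !ffunE centered_repK. Qed.

Lemma norm_coboundary_le (V : finType) (X : simplicial_complex V)
    (o : orientation X) (m : nat) (beta : cochain X m int) (b : int)
    (tau : msimplex X m.+1) :
  0 <= b -> (forall sigma, `|beta sigma| <= b) ->
  `|coboundary o beta tau| <= b * m.+2%:Z.
Proof.
move=> b_ge0 beta_le; rewrite ffunE; apply: le_trans (ler_norm_sum _ _ _) _.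
(* The factor [m.+2] is the number of vertices of [tau], which bounds the total absolute
   incidence. *)
have /eqP <- : #|val tau| == m.+2 by have := valP tau; rewrite inE => /andP[].
apply: le_trans (ler_wpM2l b_ge0 (sum_norm_incidence_le o m (val tau))).
rewrite mulr_sumr; apply: ler_sum => sigma _.
(* Over [int], the integer multiple [*~] is the ordinary product. *)
by rewrite -mulrzr intz normrM ler_wpM2r.
Qed.

Lemma cocycle_of_reduction (p : nat) (V : finType) (X : simplicial_complex V)
    (o : orientation X) (m : nat) (beta : cochain X m int) :
  prime p -> (forall sigma, beta sigma \in coef_range m p) ->
  cocycle o (reduction p beta) -> cocycle o beta.
Proof.
move=> p_prime beta_range; rewrite /cocycle coboundary_reduction => red0.
apply/ffunP => tau; rewrite [RHS]ffunE.
have p_dvd : (p %| `|coboundary o beta tau|)%N.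
  rewrite -intr_Fp_eq0 //; apply/eqP.
  by have /ffunP/(_ tau) := red0; rewrite [LHS]ffunE [RHS]ffunE.
have beta_le sigma : `|beta sigma| <= (p.-1 %/ m.+2)%N%:Z.
  by have := beta_range sigma; rewrite inE ler_norml.
have := norm_coboundary_le o tau (le0z_nat _) beta_le.
rewrite -abszE -PoszM lez_nat => cob_le.
(* A nonzero multiple of [p] has absolute value at least [p], whereas the floor times [m.+2] is at
   most [p.-1]. *)
apply/eqP; rewrite -absz_eq0 -leqn0 leqNgt; apply/negP => cob_gt0.
have := leq_trans (dvdn_leq cob_gt0 p_dvd) (leq_trans cob_le (leq_trunc_div _ _)).
by rewrite leqNgt prednK ?prime_gt0 // leqnn.
Qed.

Theorem corollary3p4 (V : finType) (X : simplicial_complex V)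
    (o : orientation X) (m p : nat) (p_prime : prime p) (p_odd : odd p)
    (alphap : cochain X m 'F_p) (alphap_cocycle : cocycle o alphap)
    (r : 'F_p) (r_neq0 : r != 0)
    (r_range : has_coefs_in (coef_range m p) (r *: alphap)) :
  let beta : cochain X m int := centered_lift (r *: alphap) in
  cocycle o beta /\
  (forall s : int, s%:~R = r^-1 :> 'F_p ->
     cocycle o (s *: beta) /\ reduction p (s *: beta) = alphap).
Proof.
move=> beta; have beta_cocycle : cocycle o beta.
  apply: (cocycle_of_reduction p_prime r_range).
  (* The reduction of [beta] is [r *: alphap], a multiple of a cocycle. *)
  by rewrite centered_liftK //; apply: cocycleZ.
split=> // s s_inv; split; first exact: cocycleZ.
(* Modulo [p], [s] becomes the inverse of [r] and cancels the scaling. *)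
by rewrite reductionZ s_inv centered_liftK // scalerA mulVf // scale1r.
Qed.
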